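(* For every integer $d\ge 3$, there exist infinitely many positive integers $a$ such that $a$, $a+F_d$, and $a+2F_d$ are all Zeckendorf-Niven and $s_Z(a)=s_Z(a+F_d)=s_Z(a+2F_d)$.
   Context: Let $F_i$ be the Fibonacci numbers: $F_0=0$, $F_1=1$, $F_i=F_{i-1}+F_{i-2}$ for $i\ge 2$. By Zeckendorf's theorem, every positive integer $n$ has a unique sequence $(\zeta_i(n))_{i=2}^\infty$ with $\zeta_i(n)\in\{0,1\}$ and $\zeta_i(n)+\zeta_{i+1}(n)\le 1$ for all $i\ge 2$, such that $n=\sum_{i=2}^\infty \zeta_i(n)F_i$ (the Zeckendorf decomposition of $n$). Put $s_Z(n)=\sum_{i=2}^\infty\zeta_i(n)$. A positive integer $n$ is called Zeckendorf-Niven if $s_Z(n)$ divides $n$. *)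

(* Defs.v *)
From mathcomp Require Import all_boot zify.
From mathcomp Require Import classical_sets cardinality.

Set Implicit Arguments.
Unset Strict Implicit.
Unset Printing Implicit Defensive.

Fixpoint fib (n : nat) : nat :=
  if n is (n''.+1 as n').+1 then fib n' + fib n'' else n.

(* Only the digits z i with 2 <= i are meaningful. The infinite sum
   \sum_(2 <= i) z i * F_i is encoded by a bound N past which z vanishes. *)
Definition zeckendorf (n : nat) (z : nat -> bool) : Prop :=
  (forall i, 2 <= i -> z i + z i.+1 <= 1) /\
  exists2 N, forall i, N <= i -> z i = false
           & n = \sum_(2 <= i < N) z i * fib i.

(* Greedy expansion of m over F_2, ..., F_(k+1). *)
Fixpoint zeck_greedy (k m i : nat) : bool :=
  if k is k'.+1 then
    if fib k.+1 <= m then (i == k.+1) || zeck_greedy k' (m - fib k.+1) i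
    else zeck_greedy k' m i
  else false.

(* The Zeckendorf digits of n; see zetaP and zeta_unique. Starting the
   expansion at F_(n+1) is enough because n < F_(n+2). *)
Definition zeta (n i : nat) : bool := zeck_greedy n n i.

(* All digits of n of index at least n.+2 vanish; see sZE. *)
Definition sZ (n : nat) : nat := \sum_(2 <= i < n.+2) zeta n i.

Definition zeckendorf_niven (n : nat) : bool := (0 < n) && (sZ n %| n).

Lemma sum2_recr (f : nat -> nat) k : 2 <= k ->
  \sum_(2 <= i < k.+1) f i = \sum_(2 <= i < k) f i + f k.
Proof. by move=> k2; rewrite big_nat_recr. Qed.

Lemma sum2_widen (f : nat -> nat) N M : N <= M ->
  (forall i, N <= i -> f i = 0) ->
  \sum_(2 <= i < N) f i = \sum_(2 <= i < M) f i.
Proof.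
move=> leNM f0; elim: M leNM => [|M IHM]; first by rewrite leqn0 => /eqP->.
rewrite leq_eqVlt => /orP[/eqP->//|]; rewrite ltnS => leNM.
rewrite IHM //; case: (leqP 2 M) => M2; last by rewrite !big_geq //; lia.
by rewrite sum2_recr // f0 // addn0.
Qed.

Lemma fibSS n : fib n.+2 = fib n.+1 + fib n.
Proof. by []. Qed.

Lemma fib_gt0 n : 0 < fib n.+1.
Proof. by elim: n => // n IHn; rewrite fibSS addn_gt0 IHn. Qed.

Lemma ltn_fib n : n < fib n.+2.
Proof.
elim: n => // n IHn; rewrite fibSS.
by have := fib_gt0 n; lia.
Qed.

Lemma zeck_greedyS k m i :
  zeck_greedy k.+1 m i =
    if fib k.+2 <= m then (i == k.+2) || zeck_greedy k (m - fib k.+2) i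
    else zeck_greedy k m i.
Proof. by []. Qed.

Lemma zeck_greedy_bound k m i :
  zeck_greedy k m i -> 2 <= i < k.+2 /\ fib i <= m.
Proof.
elim: k m => // k IHk m; rewrite zeck_greedyS; case: ifP => [le_km|_]; last first.
  by move=> /IHk[? ?]; split=> //; lia.
by case/orP => [/eqP->|/IHk[? ?]]; split=> //; lia.
Qed.

Lemma zeck_greedy_out k m i : k.+2 <= i -> zeck_greedy k m i = false.
Proof. by move=> ?; apply/negP => /zeck_greedy_bound[]; lia. Qed.

Lemma zeck_greedy_sum k m : m < fib k.+2 ->
  \sum_(2 <= i < k.+2) zeck_greedy k m i * fib i = m.
Proof.
elim: k m => [|k IHk] m lt_m; first by rewrite big_geq //; case: m lt_m.
rewrite sum2_recr //; under eq_bigr => i _ do rewrite zeck_greedyS.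
rewrite zeck_greedyS; case: ifP => le_m.
  rewrite eqxx mul1n.
  rewrite (eq_big_nat _ _ (F2 := fun i => zeck_greedy k (m - fib k.+2) i * fib i)).
    rewrite IHk; first exact: subnK.
    by move: lt_m; rewrite fibSS; have := fibSS k; lia.
  by move=> i ?; rewrite (_ : i == k.+2 = false) ?orFb //; lia.
rewrite zeck_greedy_out // mul0n addn0 IHk //.
by lia.
Qed.

Lemma zeck_greedy_sparse k m i : m < fib k.+2 ->
  zeck_greedy k m i -> zeck_greedy k m i.+1 -> False.
Proof.
elim: k m => // k IHk m lt_m; rewrite !zeck_greedyS.
case: ifP => le_m; last by apply: IHk; lia.
have lt_m' : m - fib k.+2 < fib k.+1 by move: lt_m; rewrite fibSS; lia.
case/orP => [/eqP->|di] /orP[/eqP|dSi].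
- by lia.
- by have [] := zeck_greedy_bound dSi; lia.
- by move=> [ei]; subst i; have [] := zeck_greedy_bound di; lia.
by apply: (IHk (m - fib k.+2)) di dSi; rewrite fibSS ltn_addr.
Qed.

Lemma zetaP n : zeckendorf n (zeta n).
Proof.
split=> [i _|]; last first.
  exists n.+2 => [i|]; first exact: zeck_greedy_out.
  by rewrite zeck_greedy_sum // ltn_fib.
have := @zeck_greedy_sparse n n i (ltn_fib n); rewrite /zeta.
by case: zeck_greedy; case: zeck_greedy => // /(_ isT isT).
Qed.

Lemma zeckendorf_sum_lt (z : nat -> bool) k : (forall i, 2 <= i -> z i + z i.+1 <= 1) ->
  \sum_(2 <= i < k.+1) z i * fib i < fib k.+1.
Proof.
move=> sparse; elim/ltn_ind: k => -[|[|k]] IHk; try by rewrite big_geq.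
rewrite sum2_recr //.
case zk: (z k.+2); last first.
  by have := IHk k.+1 (ltnSn _); rewrite mul0n [fib k.+3]fibSS; lia.
rewrite mul1n [fib k.+3]fibSS addnC ltn_add2l.
case: k IHk zk => [|k] IHk zk; first by rewrite big_geq.
rewrite sum2_recr // (_ : z k.+2 = false) ?mul0n ?addn0; last first.
  by have := sparse k.+2 isT; rewrite zk; case: (z k.+2).
exact: IHk.
Qed.

Lemma zeckendorf_unique n z1 z2 : zeckendorf n z1 -> zeckendorf n z2 ->
  forall i, 2 <= i -> z1 i = z2 i.
Proof.
move=> [sp1 [N1 out1 n1]] [sp2 [N2 out2 n2]].
pose N := maxn N1 N2.
have eqn : \sum_(2 <= i < N) z1 i * fib i = \sum_(2 <= i < N) z2 i * fib i.
  rewrite -[LHS](@sum2_widen _ N1 N) ?leq_maxl //; last by move=> i /out1 /= ->.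
  rewrite -[RHS](@sum2_widen _ N2 N) ?leq_maxr //; last by move=> i /out2 /= ->.
  by rewrite -n1.
have lowE k : \sum_(2 <= i < k) z1 i * fib i = \sum_(2 <= i < k) z2 i * fib i ->
    forall i, 2 <= i < k -> z1 i = z2 i.
  elim: k => [|k IHk]; first by move=> _ i; lia.
  case: (leqP 2 k) => [k2|? _ i]; last by lia.
  rewrite !sum2_recr // => eqk.
  have := zeckendorf_sum_lt k.-1 sp1; have := zeckendorf_sum_lt k.-1 sp2.
  rewrite prednK; last by lia.
  move=> lt2 lt1; have zk : z1 k = z2 k.
    by move: eqk; case: (z1 k); case: (z2 k) => //=; lia.
  move: eqk; rewrite zk => /addIn/IHk eqlow i /andP[i2].
  rewrite ltnS leq_eqVlt => /orP[/eqP->//|ik].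
  by apply: eqlow; rewrite i2.
move=> i i2; case: (ltnP i N) => iN; first by apply: (lowE N eqn); rewrite i2.
move: iN; rewrite geq_max => /andP[? ?].
by rewrite out1 // out2.
Qed.

Lemma zeta_unique n z : zeckendorf n z -> forall i, 2 <= i -> z i = zeta n i.
Proof. by move/zeckendorf_unique; apply; apply: zetaP. Qed.

Lemma sZE n N : (forall i, N <= i -> zeta n i = false) ->
  sZ n = \sum_(2 <= i < N) zeta n i.
Proof.
move=> out; rewrite /sZ (@sum2_widen _ n.+2 (maxn n.+2 N)) ?leq_maxl //.
  rewrite [RHS](@sum2_widen _ N (maxn n.+2 N)) ?leq_maxr //.
  by move=> i /out /= ->.
by move=> i ?; rewrite /zeta zeck_greedy_out.
Qed.

(* Main.v *)
Require Import Defs.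
From mathcomp Require Import all_boot.
From mathcomp Require Import classical_sets cardinality.
From mathcomp Require Import zify ring.

(** Since F_(d-1) + F_d = F_(d+1) and F_(d-1) + 2 F_d = F_(d+2), the number
    a = F_(d-1) + R keeps its digit sum when F_d or 2 F_d is added, for every
    sum R of sparse Fibonacci numbers of large index. If R has F_d - 1 terms,
    the common digit sum is F_d, and it remains to get F_d | a, that is
    R = F_(d-2) mod F_d. As F_(d-1)^4 = 1 mod F_d by Cassini's identity, 4d is a
    period of F mod F_d, so R can be one F_i with i = d-2 mod 4d plus F_d - 2
    terms whose indices are multiples of 4d. *)

Lemma leq_fib m n : m <= n -> fib m <= fib n.
Proof.
move=> /subnK <-; elim: (n - m) => // k IHk; apply: (leq_trans IHk).
rewrite addSn; case: (k + m) => // l.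
by rewrite fibSS leq_addr.
Qed.

Lemma fibD m n : fib (m + n.+1) = fib m.+1 * fib n.+1 + fib m * fib n.
Proof.
elim: m n => [|m IHm] n; first by rewrite add0n mul1n mul0n addn0.
by rewrite addSnnS IHm !fibSS; ring.
Qed.

(** Cassini's identity with F_(n-1) replaced by F_(n+1) - F_n and all subtractions cleared. The
    disjunction records the sign, which flips at each step. *)
Lemma fib_cassini n :
  fib n.+1 ^ 2 + 1 = fib n ^ 2 + fib n * fib n.+1 \/
  fib n.+1 ^ 2 = fib n ^ 2 + fib n * fib n.+1 + 1.
Proof.
elim: n => [|n IHn]; first by right.
by rewrite fibSS; case: IHn => IHn; [right | left]; nia.
Qed.

Lemma fib_exp4_mod n : fib n ^ 4 = 1 %[mod fib n.+1].
Proof.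
case: n => [|n]; first by rewrite !modn1.
have x0 := fib_gt0 n; set x := fib n.+1 in x0 *.
apply/eqP; rewrite eqn_mod_dvd ?expn_gt0 ?x0 //.
have -> : x ^ 4 - 1 = (x ^ 2 - 1) * (x ^ 2 + 1).
  by rewrite -(exp1n 2) -subn_sqr -expnM exp1n.
(* The sign in Cassini decides which of the two factors is divisible by [fib n.+2]. *)
have [E|E] := fib_cassini n.+1; rewrite -/x in E.
  apply: dvdn_mulr; rewrite -(@dvdn_addl (x * fib n.+2)) ?dvdn_mull //.
  have -> : x ^ 2 - 1 + x * fib n.+2 = fib n.+2 ^ 2 by nia.
  exact: dvdn_mulr.
apply: dvdn_mull; rewrite -(@dvdn_addl (x * fib n.+2)) ?dvdn_mull //.
have -> : x ^ 2 + 1 + x * fib n.+2 = fib n.+2 ^ 2 by lia.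
exact: dvdn_mulr.
Qed.

Lemma fib_addn_mod d i : fib (i + d.+1) = fib i * fib d %[mod fib d.+1].
Proof. by rewrite fibD modnMDl. Qed.

Lemma fib_period d k i : fib (i + 4 * d.+1 * k) = fib i %[mod fib d.+1].
Proof.
(* Each shift of the index by [d.+1] multiplies by [fib d]; four shifts give the factor [fib d ^ 4],
   which is 1. *)
have step e : fib (i + d.+1 * e) = fib i * fib d ^ e %[mod fib d.+1].
  elim: e => [|e IHe]; first by rewrite muln0 addn0 muln1.
  by rewrite mulnSr addnA fib_addn_mod -modnMml IHe modnMml expnSr mulnA.
rewrite [4 * _]mulnC -mulnA step // expnM -modnMmr -modnXm fib_exp4_mod.
by rewrite modnXm exp1n modnMmr muln1.
Qed.

(** As n < F_k, the digits of n vanish from index k on, so switching on digit k+1 keeps the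
    expansion sparse; uniqueness does the rest. *)
Lemma sZ_fib_add k n : 0 < k -> n < fib k -> sZ (fib k.+1 + n) = (sZ n).+1.
Proof.
move=> k0 nk; have [sparse _] := zetaP n.
have out i : k <= i -> zeta n i = false.
  move=> ki; apply/negP => /zeck_greedy_bound[_].
  by have := leq_fib _ _ ki; lia.
pose z i := (i == k.+1) || zeta n i.
have zlow i : i < k.+1 -> z i = zeta n i by rewrite /z; case: eqP => //; lia.
have zk : z k.+1 by rewrite /z eqxx.
have zout i : k.+2 <= i -> z i = false.
  by move=> ki; rewrite /z out; [case: eqP => //; lia | lia].
have sumz (f : nat -> nat) : \sum_(2 <= i < k.+2) z i * f i =
    \sum_(2 <= i < k.+1) zeta n i * f i + f k.+1.
  rewrite sum2_recr // zk mul1n; congr (_ + _).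
  by apply: eq_big_nat => i /andP[_ ik]; rewrite zlow.
have sumn : \sum_(2 <= i < k.+1) zeta n i * fib i = n.
  have [_ [N outN {2}->]] := zetaP n.
  rewrite (@sum2_widen _ k.+1 (maxn k.+1 N)) ?leq_maxl //; last first.
    by move=> i ki; rewrite out //; lia.
  rewrite [RHS](@sum2_widen _ N (maxn k.+1 N)) ?leq_maxr //.
  by move=> i /outN ->.
have zP : zeckendorf (fib k.+1 + n) z.
  split=> [i i2|]; last first.
    by exists k.+2 => //; rewrite sumz sumn addnC.
  have := sparse i i2; rewrite /z.
  case: eqP => [->|_]; first by rewrite !out; [case: eqP => //; lia | lia..].
  case: eqP => [[->]|//]; by rewrite !out.
have zE := zeta_unique zP.
rewrite (@sZE _ k.+2) => [|i ki]; last by rewrite -zE ?zout //; lia.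
rewrite (@sZE n k.+1) => [|i ki]; last by rewrite out //; lia.
have := sumz (fun=> 1); rewrite addn1.
under eq_bigr do rewrite muln1.
under [in RHS]eq_bigr do rewrite muln1.
by move=> <-; apply: eq_big_nat => i /andP[i2 _]; rewrite zE.
Qed.

Lemma sZ_fib k : 0 < k -> sZ (fib k.+1) = 1.
Proof.
by case: k => // k _; rewrite -[fib _]addn0 sZ_fib_add ?fib_gt0 // /sZ big_geq.
Qed.

Lemma sZ_fib_tower p q m x : 2 < p -> x < fib (p * q.+1).-1 ->
  sZ (\sum_(j < m) fib (p * (q + j.+1)) + x) = m + sZ x.
Proof.
move=> p2 xq.
(* The induction also carries a size bound, so that the next term can be added by [sZ_fib_add]. *)
suff [//] : sZ (\sum_(j < m) fib (p * (q + j.+1)) + x) = m + sZ x /\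
  \sum_(j < m) fib (p * (q + j.+1)) + x < fib (p * (q + m.+1)).-1.
elim: m => [|m [IHs IHb]]; first by rewrite big_ord0 !add0n addn1.
rewrite big_ord_recr /=.
rewrite [_ + fib _]addnC -addnA.
have : 1 < p * (q + m.+1) by nia.
have : (p * (q + m.+1)).+1 <= (p * (q + m.+2)).-1 by nia.
case: (p * (q + m.+1)) IHb => [//|k] /= IHb le_k k0; split.
  by rewrite sZ_fib_add // IHs.
apply: leq_trans (leq_fib _ _ le_k).
by rewrite fibSS ltn_add2l.
Qed.

Theorem theorem5p2 (d : nat) (hd : 3 <= d) :
  infinite_set [set a : nat |
    0 < a /\
    [/\ zeckendorf_niven a,
        zeckendorf_niven (a + fib d)
      & zeckendorf_niven (a + 2 * fib d)] /\
    sZ a = sZ (a + fib d) /\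
    sZ (a + fib d) = sZ (a + 2 * fib d)]%classic.
Proof.
case: d hd => [|[|[|d]]] // _.
(* From here [D] is the index d of the statement and [d] is [D] - 3. *)
set D := d.+3; set F := fib D.
have F2 : 2 <= F by have := @leq_fib 3 D; apply.
(* [T q] is the R of the overview; [q] pushes all its indices upwards. *)
pose T q := \sum_(j < F - 2) fib (4 * D * (q.+1 + j.+1)) + fib (4 * D * q.+1 + d.+1).
(* Needed for F_(D-1), F_(D+1) and F_(D+2), that is e = d+1, d+3, d+4. The terms number (F - 2) + 1
   + 1 = F. *)
have sT q e : 0 < e <= d.+4 -> sZ (T q + fib e.+1) = F.
  move=> /andP[e0 ed].
  have lt_e : fib e.+1 < fib (4 * D * q.+1 + d).
    apply: leq_ltn_trans (_ : fib d.+4.+1 < _); first exact: leq_fib.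
    apply: leq_trans (_ : fib d.+4.+2 <= _); last by apply: leq_fib; rewrite /D; nia.
    by rewrite [fib d.+4.+2]fibSS; have := fib_gt0 d.+3; lia.
  rewrite -addnA sZ_fib_tower; last 2 first.
  - by rewrite /D; lia.
  - rewrite addnS; apply: leq_trans (_ : fib (4 * D * q.+1 + d).+2 <= _).
      by rewrite fibSS ltn_add2l.
    by apply: leq_fib; rewrite /D; nia.
  by rewrite addnS sZ_fib_add ?sZ_fib //; lia.
have dvdT q : F %| T q + fib d.+2.
  rewrite -addnA; apply: dvdn_add.
    (* Writing the index as 0 plus a multiple of the period reduces each term to F_0 = 0. *)
    apply: dvdn_sum => j _; rewrite /dvdn -[_ * (_ + _)]add0n.
    by rewrite fib_period mod0n.
  rewrite /dvdn -modnDml (addnC (4 * D * q.+1)) fib_period modnDml.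
  by rewrite addnC -fibSS modnn.
pose a q := T q + fib d.+2.
have a1 q : a q + F = T q + fib d.+4 by rewrite /a /F /D -addnA [fib d.+4]fibSS; lia.
have a2 q : a q + 2 * F = T q + fib d.+4.+1.
  by rewrite mul2n -addnn addnA a1 /F /D -addnA -fibSS.
have a_ge q : q < a q.
  have : q.+1 < fib q.+3 by exact: ltn_fib.
  have : fib q.+3 <= fib (4 * D * q.+1 + d.+1) by apply: leq_fib; rewrite /D; nia.
  by rewrite /a /T; lia.
have s0 q : sZ (a q) = F by rewrite /a sT //; apply/andP; lia.
have s1 q : sZ (a q + F) = F by rewrite a1 sT //; apply/andP; lia.
have s2 q : sZ (a q + 2 * F) = F by rewrite a2 sT //; apply/andP; lia.
(* A member of a finite list [s] is at most [sumn s], whereas [a (sumn s)] exceeds it. *)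
move=> /finite_seqP[s sE].
have : a (sumn s) \in s.
  suff : [set` s]%classic (a (sumn s)) by [].
  rewrite -sE /=; rewrite -/D -/F s0 s1 s2.
  have a0 : 0 < a (sumn s) by apply: leq_trans (a_ge _).
  split=> //; split=> //; rewrite /zeckendorf_niven s0 s1 s2 !(ltn_addr _ a0) a0 /=.
  have dvda : F %| a (sumn s) := dvdT _.
  by split=> //; rewrite dvdn_addr // dvdn_mull.
move/perm_to_rem/perm_sumn => /= E.
by have := a_ge (sumn s); lia.
Qed.
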